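(* Let $M\in\mathbb{N}^{m\times m}$. (i) For all $i\in\{1,\ldots,m\}$, there exist $\lambda\in\mathrm{Spec}(M)$ and $d\in\mathbb{N}$ such that $\sum_{j=1}^m(M^n)_{i,j}=\Theta(n^d\lambda^n)$. (ii) For all $j\in\{1,\ldots,m\}$, there exist $\lambda\in\mathrm{Spec}(M)$ and $d\in\mathbb{N}$ such that $\sum_{i=1}^m(M^n)_{i,j}=\Theta(n^d\lambda^n)$.
   Context: $\mathbb{N}=\{0,1,2,\ldots\}$. $\mathrm{Spec}(M)$ is the multiset of (complex) eigenvalues of $M$; here $\lambda$ is a real number $\ge 0$. For non-negative sequences, $a_n=\Theta(b_n)$ means that there exist constants $c,C>0$ such that $c\,b_n\le a_n\le C\,b_n$ for all sufficiently large $n$; in particular, when $\lambda=0$, $a_n=\Theta(n^d\lambda^n)$ means that $a_n=0$ for all sufficiently large $n$. *)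

(* Defs.v *)
From mathcomp Require Import all_boot all_order all_algebra.
From mathcomp Require Import complex reals.

(* The real numbers are an arbitrary [R : realType], the complex numbers [R[i]]. *)

Set Implicit Arguments.
Unset Strict Implicit.
Unset Printing Implicit Defensive.

Import GRing.Theory Num.Theory.
Local Open Scope ring_scope.

(* Membership in Spec(M); multiplicities play no role in membership. *)
Definition in_Spec (R : realType) (m : nat) (M : 'M[nat]_m) (z : R[i]) : bool :=
  eigenvalue (map_mx (fun k : nat => k%:R : R[i]) M) z.

(* The absence of absolute values presupposes non-negative sequences. *)
Definition is_Theta (R : realType) (a b : nat -> R) : Prop :=
  exists c C : R, [/\ 0 < c, 0 < C &
    exists N : nat, forall n : nat, (N <= n)%N ->
      c * b n <= a n /\ a n <= C * b n].

(* Main.v *)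
Require Import Defs.
From mathcomp Require Import all_boot all_order all_algebra.
From mathcomp Require Import complex reals.
From mathcomp Require Import boolp classical_sets topology normedtype derive.
From mathcomp Require Import ring lra.
Set Implicit Arguments.
Unset Strict Implicit.
Unset Printing Implicit Defensive.
Import Order.TTheory GRing.Theory Num.Theory.
Import numFieldNormedType.Exports.
Local Open Scope ring_scope.

(** View [M] as a nonnegative real matrix [A] and let [s_i(n)] be the [i]-th row
sum of [A^n]. Since [s_i(n+1) <= K s_i(n)] for some constant [K], an edge
[i -> j] gives [s_j = O(s_i)]; hence all [s_i] with [i] in one strongly connected
component [C] are comparable, whatever the period of [C]. By compactness [A]
restricted to [C] has a left eigenvector [y], positive on [C], for some [l >= 0].
Then [u = sum_C y_i s_i] satisfies [u(n+1) = l u(n) + g(n)], where [g] is a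
nonnegative combination of row sums [s_j] with [j] strictly below [C]. By
induction on the number of reachable vertices [g] vanishes or is
[Theta(n^d k^n)], and solving the scalar recurrence gives the growth of [u],
hence of [s_i]. The value [l] is an eigenvalue of the whole matrix because
the matrix is block triangular. Columns follow by transposition. *)

(** * Sequences of order [n^d l^n] and their sums *)

Section Asymptotics.
Variable R : realType.
Implicit Types (a b g u : nat -> R) (l k c : R) (S : pred R).

Definition polyexp (d : nat) (l : R) (n : nat) : R := n%:R ^+ d * l ^+ n.

Lemma polyexp_ge0 d l n : 0 <= l -> 0 <= polyexp d l n.
Proof. by move=> l0; rewrite mulr_ge0 ?exprn_ge0. Qed.

(** A Bernoulli-type inequality cleared of denominators, so that [l = 0] is covered. *)
Lemma natr_exp_le l k n : 0 <= l <= k -> n%:R * (k - l) * l ^+ n <= k * k ^+ n.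
Proof.
move=> /andP[l0 lk]; have k0 : 0 <= k by apply: le_trans lk.
suff : l ^+ n * (l + n%:R * (k - l)) <= k * k ^+ n.
  apply: le_trans; rewrite [leLHS]mulrC ler_wpM2l ?exprn_ge0 //.
  by rewrite lerDr.
elim: n => [|n IH]; first by rewrite !expr0 mul0r addr0 mulr1 mul1r.
have p0 := exprn_ge0 n l0.
rewrite !exprS -natr1; apply: le_trans (ler_wpM2l k0 IH).
rewrite -subr_ge0.
have -> : k * (l ^+ n * (l + n%:R * (k - l))) -
   l * l ^+ n * (l + (n%:R + 1) * (k - l)) =
   l ^+ n * (k - l) * n%:R * (k - l) by ring.
by rewrite !mulr_ge0 ?subr_ge0.
Qed.

(** Each factor [n] is paid for by a larger base: [n l^n] is at most a multiple of [h^n] for [h]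
    midway between [l] and [k], and the remaining factors are left to the induction at base [h]. *)
Lemma polyexp_le_exp d l k : 0 <= l < k ->
  exists2 C, 0 < C & forall n, polyexp d l n <= C * k ^+ n.
Proof.
elim: d l => [|d IH] l /andP[l0 lk].
  exists 1 => // n; rewrite /polyexp expr0 !mul1r lerXn2r ?nnegrE //; last exact: ltW.
  by rewrite (le_trans l0) ?ltW.
have [h lh hk] : exists2 h, l < h & h < k by exists ((l + k) / 2); lra.
have [|C C0 HC] := IH h; first by rewrite hk andbT; lra.
have h0 : 0 < h by lra.
exists ((h - l)^-1 * h * C) => [|n].
  by rewrite !mulr_gt0 ?invr_gt0 ?subr_gt0.
have key : n%:R * l ^+ n <= (h - l)^-1 * h * h ^+ n.
  rewrite -mulrA ler_pdivlMl ?subr_gt0 //.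
  have := @natr_exp_le l h n; rewrite l0 ltW // => /(_ isT).
  by rewrite mulrAC mulrC.
rewrite /polyexp exprS mulrAC.
have nd : 0 <= (n%:R : R) ^+ d by rewrite exprn_ge0.
apply: le_trans (ler_wpM2r nd key) _.
rewrite -[leLHS]mulrA -[leRHS]mulrA ler_pM2l; first by rewrite mulrC; exact: HC.
by rewrite mulr_gt0 ?invr_gt0 ?subr_gt0.
Qed.

(** Orders compare lexicographically, first by base and then by degree. Index 0 is left out because
    there [n ^+ d] is 1 for [d = 0] but 0 for [d > 0]. *)
Lemma polyexp_total d l d' l' : 0 <= l -> 0 <= l' ->
  (exists2 D, 0 < D & forall n, (0 < n)%N -> polyexp d l n <= D * polyexp d' l' n) \/
  (exists2 D, 0 < D & forall n, (0 < n)%N -> polyexp d' l' n <= D * polyexp d l n).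
Proof.
move=> l0 l0'.
have lt e m e' m' : 0 <= m < m' ->
    exists2 D, 0 < D & forall n, (0 < n)%N -> polyexp e m n <= D * polyexp e' m' n.
  move=> /[dup] /andP[m0 mm] /(polyexp_le_exp e)[C C0 HC]; exists C => // n n0.
  apply: le_trans (HC n) _; rewrite ler_pM2l // ler_peMl ?exprn_ge0 //.
    by rewrite ltW ?(le_lt_trans m0).
  by rewrite exprn_ege1 // ler1n.
have [ll|ll|<-] := ltgtP l l'.
- by left; apply: lt; rewrite l0.
- by right; apply: lt; rewrite l0'.
have le e e' : (e <= e')%N ->
    exists2 D, 0 < D & forall n, (0 < n)%N -> polyexp e l n <= D * polyexp e' l n.
  move=> ee; exists 1 => // n n0; rewrite mul1r ler_wpM2r ?exprn_ge0 //.
  by rewrite ler_weXn2l // ler1n.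
by have [/le|/ltnW/le] := leqP d d'; [left|right].
Qed.

Lemma is_Theta_comparable a a' b c C : 0 < c -> 0 < C ->
  (forall n, c * a n <= a' n <= C * a n) -> is_Theta a b -> is_Theta a' b.
Proof.
move=> c0 C0 H [c1 [C1 [c10 C10 [N HN]]]].
exists (c * c1), (C * C1); split; rewrite ?mulr_gt0 //.
exists N => n /HN [lo up]; have /andP[lo' up'] := H n; split.
  by apply: le_trans lo'; rewrite -mulrA ler_pM2l.
by apply: le_trans up' _; rewrite -mulrA ler_pM2l.
Qed.

Lemma is_Theta_eq a a' b : a =1 a' -> is_Theta a b -> is_Theta a' b.
Proof.
by move=> e; apply: (@is_Theta_comparable _ _ _ 1 1) => // n; rewrite -e mul1r lexx.
Qed.

Lemma is_ThetaD a a' b b' D : 0 < D -> (forall n, 0 <= b' n) ->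
  (forall n, (0 < n)%N -> b' n <= D * b n) ->
  is_Theta a b -> is_Theta a' b' -> is_Theta (fun n => a n + a' n) b.
Proof.
move=> D0 b0 bD [c [C [c0 C0 [N HN]]]] [c' [C' [c0' C0' [N' HN']]]].
exists c, (C + C' * D); split; rewrite ?addr_gt0 ?mulr_gt0 //.
exists (maxn 1 (maxn N N')) => n; rewrite !geq_max => /and3P[n0 /HN[lo up] /HN'[lo' up']].
split; first by rewrite -[leLHS]addr0 lerD // (le_trans _ lo') // mulr_ge0 // ltW.
by rewrite mulrDl lerD // (le_trans up') // -mulrA ler_pM2l //; exact: bD.
Qed.

(** [S] is later the set of eigenvalues, so closure properties of this predicate also record that
    each base is an eigenvalue. *)
Definition polyexp_growth S a :=
  exists l d, [/\ 0 <= l, S l & is_Theta a (polyexp d l)].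

Lemma polyexp_growthD S a a' : polyexp_growth S a -> polyexp_growth S a' ->
  polyexp_growth S (fun n => a n + a' n).
Proof.
move=> [l [d [l0 Sl Ha]]] [l' [d' [l0' Sl' Ha']]].
have [[D D0 HD]|[D D0 HD]] := polyexp_total d d' l0 l0'.
  exists l', d'; split => //.
  apply: (@is_Theta_eq (fun n => a' n + a n)) => [n|]; first exact: addrC.
  by apply: (is_ThetaD D0 _ HD) => // n; exact: polyexp_ge0.
exists l, d; split => //.
by apply: (is_ThetaD D0 _ HD) => // n; exact: polyexp_ge0.
Qed.

(** An empty sum is identically 0, which has order [n^d l^n] only for [l = 0]; as 0 may fail [S],
    this case is kept apart. *)
Lemma polyexp_growth_sum S (I : Type) (r : seq I) (P : pred I) (F : I -> nat -> R) :
  (forall i, P i -> polyexp_growth S (F i)) ->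
  (forall n, \sum_(i <- r | P i) F i n = 0) \/
  polyexp_growth S (fun n => \sum_(i <- r | P i) F i n).
Proof.
move=> H; elim: r => [|i r IH]; first by left=> n; rewrite big_nil.
have [Pi|nPi] := boolP (P i); last first.
  by case: IH => [IH|[l [d [l0 Sl Ha]]]]; [left=> n|right; exists l, d; split=> //];
   [rewrite big_cons (negbTE nPi)| apply: is_Theta_eq Ha => n; rewrite big_cons (negbTE nPi)].
right; case: IH => [IH|IH].
  have [l [d [l0 Sl Ha]]] := H i Pi; exists l, d; split=> //.
  by apply: is_Theta_eq Ha => n; rewrite big_cons Pi IH addr0.
have [l [d [l0 Sl Ha]]] := polyexp_growthD (H i Pi) IH; exists l, d; split=> //.
by apply: is_Theta_eq Ha => n; rewrite big_cons Pi.
Qed.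

(** * The scalar recurrence [u(n+1) = k u(n) + g(n)] *)

Section Recurrence.
Variables (k : R) (u g : nat -> R).
Hypotheses (k0 : 0 <= k) (u0 : 0 < u 0%N) (g0 : forall n, 0 <= g n).
Hypothesis rec : forall n, u n.+1 = k * u n + g n.

Lemma rec_ge_exp n : k ^+ n * u 0%N <= u n.
Proof.
elim: n => [|n IH]; first by rewrite expr0 mul1r.
by rewrite rec exprS -mulrA -[leLHS]addr0 lerD // ler_wpM2l.
Qed.

Lemma rec_ge0 n : 0 <= u n.
Proof. by apply: le_trans (rec_ge_exp n); rewrite mulr_ge0 ?exprn_ge0 // ltW. Qed.

Lemma rec_homogeneous : (forall n, g n = 0) -> is_Theta u (polyexp 0%N k).
Proof.
move=> gz; have uE n : u n = u 0%N * polyexp 0%N k n.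
  rewrite /polyexp mul1r; elim: n => [|n IH]; first by rewrite mulr1.
  by rewrite rec gz addr0 IH exprS; ring.
by exists (u 0%N), (u 0%N); split=> //; exists 0%N => n _; rewrite -uE.
Qed.

(* Barrier: [E k^n - D h^n], where [l < h < k], satisfies the recurrence with >=. *)
Lemma rec_dominant d l : 0 <= l < k -> is_Theta g (polyexp d l) ->
  is_Theta u (polyexp 0%N k).
Proof.
move=> /andP[l0 lk] [c [C [c0 C0 [N HN]]]].
have [h lh hk] : exists2 h, l < h & h < k by exists ((l + k) / 2); lra.
have h0 : 0 < h by lra.
have kp : 0 < k by lra.
have [|B B0 HB] := @polyexp_le_exp d l h; first by rewrite l0.
(* With this [D], [D * (k - h) * h ^+ n] equals [C * B * h ^+ n], a bound on [g n] for [n >= N]. *)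
pose D := C * B / (k - h).
have D0 : 0 < D by rewrite /D divr_gt0 ?mulr_gt0 ?subr_gt0.
have ug n : (N <= n)%N -> u n <= (u N + D * h ^+ N) / k ^+ N * k ^+ n - D * h ^+ n.
  elim: n => [|n IH].
    by rewrite leqn0 => /eqP->; rewrite !expr0 divr1 mulr1 addrK.
  rewrite leq_eqVlt => /orP[/eqP<-|].
    by rewrite divfK ?addrK // expf_neq0 // gt_eqF.
  rewrite ltnS => Nn; have [_ up] := HN _ Nn.
  have gn : g n <= D * (k - h) * h ^+ n.
    rewrite divfK ?gt_eqF ?subr_gt0 // (le_trans up) // -mulrA ler_pM2l //; exact: HB.
  rewrite rec; apply: le_trans (lerD (ler_wpM2l k0 (IH Nn)) gn) _.
  by rewrite le_eqVlt; apply/orP; left; apply/eqP; rewrite !exprS; ring.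
exists (u 0%N), ((u N + D * h ^+ N) / k ^+ N); split=> //.
  rewrite divr_gt0 ?exprn_gt0 // -[ltLHS]addr0 ler_ltD ?rec_ge0 //.
  by rewrite mulr_gt0 ?exprn_gt0.
exists N => n Nn; rewrite /polyexp mul1r; split.
  by rewrite mulrC; exact: rec_ge_exp.
by apply: le_trans (ug n Nn) _; rewrite gerBl mulr_ge0 ?exprn_ge0 // ltW.
Qed.

(** The lower bound comes from [u n.+1 >= g n], as [n^d l^n] is comparable with its shift. The upper
    bound [E n^d l^n] propagates once [C <= E (l - k)]. *)
Lemma rec_dominated d l : k < l -> is_Theta g (polyexp d l) ->
  is_Theta u (polyexp d l).
Proof.
move=> kl [c [C [c0 C0 [N HN]]]].
have l0 : 0 < l by apply: le_lt_trans kl.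
have nX n : (n%:R : R) ^+ d <= n.+1%:R ^+ d by rewrite lerXn2r ?nnegrE // ler_nat.
pose N1 := N.+1.
have f0 n : (0 < n)%N -> 0 < polyexp d l n.
  by move=> n0; rewrite mulr_gt0 ?exprn_gt0 // ltr0n.
(* The first summand makes [E (l - k)] at least [C]; the second covers the initial index [N1], which
   is positive so that [polyexp d l N1] is nonzero. *)
pose E := C / (l - k) + u N1 / polyexp d l N1.
have E1 : C <= E * (l - k).
  rewrite mulrDl divfK ?gt_eqF ?subr_gt0 // lerDl mulr_ge0 ?divr_ge0 ?rec_ge0 //.
    by rewrite ltW // f0.
  by rewrite subr_ge0 ltW.
have E0 : 0 < E.
  by rewrite -(pmulr_lgt0 _ (_ : 0 < l - k)) ?subr_gt0 //; exact: lt_le_trans E1.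
have up n : (N1 <= n)%N -> u n <= E * polyexp d l n.
  elim: n => [//|n IH].
  rewrite leq_eqVlt => /orP[/eqP<-|].
    rewrite mulrDl divfK ?gt_eqF ?f0 // lerDr.
    by rewrite mulr_ge0 ?divr_ge0 ?polyexp_ge0 ?subr_ge0 // ltW.
  rewrite ltnS => Nn; have [_ gup] := HN _ (ltnW Nn).
  rewrite rec; apply: le_trans (lerD (ler_wpM2l k0 (IH Nn)) gup) _.
  have fn := ltW (f0 n (leq_ltn_trans (leq0n _) Nn)).
  apply: (@le_trans _ _ (E * l * polyexp d l n)).
    have := ler_wpM2r fn E1; rewrite mulrBr mulrBl; lra.
  rewrite -mulrA ler_pM2l // /polyexp exprS mulrCA ler_wpM2r //.
  by rewrite mulr_ge0 ?exprn_ge0 // ltW.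
have [cl cl0] : exists2 c', 0 < c' & forall n, (0 < n)%N ->
    c' * polyexp d l n.+1 <= c * polyexp d l n.
  exists (c / (2 ^+ d * l)) => [|n n0].
    by rewrite divr_gt0 ?mulr_gt0 ?exprn_gt0.
  rewrite -mulrA ler_pM2l // ler_pdivrMl ?mulr_gt0 ?exprn_gt0 //.
  rewrite /polyexp exprS.
  have -> : 2 ^+ d * l * (n%:R ^+ d * l ^+ n) = (2 * n%:R) ^+ d * (l * l ^+ n) :> R.
    by rewrite exprMn; ring.
  rewrite ler_pM2r ?mulr_gt0 ?exprn_gt0 // lerXn2r ?nnegrE //.
    by rewrite mulr_ge0.
  by rewrite -natrM ler_nat mul2n -addnn -addn1 leq_add2l.
move=> clP; exists cl, E; split=> //; exists N1.+1 => -[//|n]; rewrite ltnS => Nn.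
split; last exact: up (leqW Nn).
apply: le_trans (clP n (leq_ltn_trans (leq0n _) Nn)) _.
have [lo _] := HN _ (ltnW Nn); apply: le_trans lo _.
by rewrite rec lerDr mulr_ge0 // rec_ge0.
Qed.

(** For [k = 0] the order forces [g], hence [u], to vanish eventually, so no degree is gained. *)
Lemma rec_resonant0 d : k = 0 -> is_Theta g (polyexp d k) ->
  is_Theta u (polyexp d k).
Proof.
move=> kz [c [C [c0 C0 [N HN]]]]; exists 1, 1; split=> //.
have fz n : (0 < n)%N -> polyexp d k n = 0.
  by move=> n0; rewrite /polyexp kz expr0n gtn_eqF // mulr0.
exists N.+2 => -[//|n]; rewrite ltnS => Nn.
have n0 : (0 < n)%N by apply: leq_ltn_trans Nn.
have [lo up] := HN _ (ltnW Nn).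
suff -> : u n.+1 = 0 by rewrite fz // mulr0.
rewrite rec kz mul0r add0r; move: lo up; rewrite fz // !mulr0 => lo up.
by apply/eqP; rewrite eq_le lo up.
Qed.

(** At equal bases the forcing accumulates and one degree is gained. Both bounds go by induction,
    using [n^d <= (n+1)^(d+1) - n^(d+1) <= H n^d] for [n > 0]. *)
Lemma rec_resonant d : 0 < k -> is_Theta g (polyexp d k) ->
  is_Theta u (polyexp d.+1 k).
Proof.
move=> kp [c [C [c0 C0 [N HN]]]].
have f0 e n : (0 < n)%N -> 0 < polyexp e k n.
  by move=> n0; rewrite mulr_gt0 ?exprn_gt0 // ltr0n.
have [H H0 HH] : exists2 H : R, 0 < H & forall n, (0 < n)%N ->
    n.+1%:R ^+ d.+1 <= n%:R ^+ d.+1 + H * n%:R ^+ d.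
  elim: d {HN} => [|e [H H0 HH]].
    by exists 1 => // n _; rewrite !expr1 expr0 mulr1 -natr1.
  exists (1 + 2 * H) => [|n n0]; first by rewrite addr_gt0 ?mulr_gt0.
  have n1 : (1 : R) <= n%:R by rewrite ler1n.
  have ne : 0 <= (n%:R : R) ^+ e by rewrite exprn_ge0.
  rewrite exprS; apply: le_trans (ler_wpM2l (ler0n _ _) (HH n n0)) _.
  rewrite -natr1 !(exprS _ e.+1) !(exprS _ e) -subr_ge0.
  set x : R := n%:R; set y := x ^+ e.
  have -> : x * (x * y) + (1 + 2 * H) * (x * y) - (x + 1) * (x * y + H * y) =
            H * y * (x - 1) by ring.
  by rewrite !mulr_ge0 ?subr_ge0 // ltW.
pose N1 := N.+1.
have uN : 0 < u N1.
  by apply: lt_le_trans (rec_ge_exp N1); rewrite mulr_gt0 ?exprn_gt0.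
pose q := u N1 / polyexp d.+1 k N1.
have q0 : 0 < q by rewrite /q divr_gt0 ?f0.
(* [e <= q] starts the lower bound at [N1], and [e H k <= c] keeps each increment within what [g]
   supplies; [E] is chosen dually. *)
pose e := Num.min q (c / k / H).
have e0 : 0 < e by rewrite /e lt_min q0 !divr_gt0.
have eq : e <= q by rewrite /e ge_min lexx.
have eH : e * H * k <= c.
  by rewrite -ler_pdivlMr // -ler_pdivlMr // /e ge_min lexx orbT.
pose E := q + C / k.
have E0 : 0 < E by rewrite /E addr_gt0 // divr_gt0.
have qE : q <= E by rewrite lerDl divr_ge0 // ltW.
have Ek : C <= E * k by rewrite -ler_pdivrMr // lerDr ltW.
clearbody e E.
exists e, E; split=> //; exists N1; elim=> [//|n IH].
rewrite leq_eqVlt => /orP[/eqP<-|].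
  split; first by rewrite -ler_pdivlMr ?f0.
  by rewrite -ler_pdivrMr ?f0.
rewrite ltnS => Nn; have {IH}[ulo uup] := IH Nn; have [lo up] := HN _ (ltnW Nn).
have n0 : (0 < n)%N by apply: leq_ltn_trans Nn.
rewrite rec; split.
  apply: le_trans (lerD (ler_wpM2l k0 ulo) lo).
  rewrite /polyexp (exprS k) -subr_ge0.
  set z := n.+1%:R ^+ d.+1; have zH := HH n n0; rewrite -/z in zH.
  have -> : k * (e * (n%:R ^+ d.+1 * k ^+ n)) + c * (n%:R ^+ d * k ^+ n) -
     e * (z * (k * k ^+ n)) =
     k ^+ n * (e * k * (n%:R ^+ d.+1 + H * n%:R ^+ d - z) + (c - e * H * k) * n%:R ^+ d).
    by ring.
  by rewrite mulr_ge0 ?exprn_ge0 // addr_ge0 ?mulr_ge0 ?subr_ge0 ?exprn_ge0 // ltW.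
apply: le_trans (lerD (ler_wpM2l k0 uup) up) _.
have nX : (n%:R : R) ^+ d <= n.+1%:R ^+ d by rewrite lerXn2r ?nnegrE // ler_nat.
rewrite /polyexp (exprS k) (exprS n.+1%:R) -natr1 in nX *.
rewrite -subr_ge0 (exprS n%:R).
set x : R := n%:R in nX *.
have -> : E * ((x + 1) * (x + 1) ^+ d * (k * k ^+ n)) -
  (k * (E * (x * x ^+ d * k ^+ n)) + C * (x ^+ d * k ^+ n)) =
  k ^+ n * (E * k * (x + 1) * ((x + 1) ^+ d - x ^+ d) + (E * k - C) * x ^+ d).
  by ring.
by rewrite mulr_ge0 ?exprn_ge0 // addr_ge0 ?mulr_ge0 ?subr_ge0 ?exprn_ge0 ?addr_ge0 // ltW.
Qed.

Lemma rec_growth S : S k -> (forall n, g n = 0) \/ polyexp_growth S g ->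
  polyexp_growth S u.
Proof.
move=> Sk [gz|[l [d [l0 Sl Hg]]]].
  by exists k, 0%N; split=> //; exact: rec_homogeneous.
have [lk|kl|lk] := ltgtP l k.
- by exists k, 0%N; split=> //; apply: (@rec_dominant d l) => //; rewrite l0.
- by exists l, d; split=> //; exact: rec_dominated.
subst l; exists k; have [kz|kp] := eqVneq k 0.
  by exists d; split=> //; exact: rec_resonant0.
by exists d.+1; split=> //; apply: rec_resonant => //; rewrite lt_def kp.
Qed.

End Recurrence.
End Asymptotics.

(** * A Perron vector by maximization over a compact set *)

Section Perron.
Variables (R : realType) (m : nat) (B : 'M[R]_m) (C : {set 'I_m}) (i0 : 'I_m).
Hypotheses (B0 : forall i j, 0 <= B i j) (i0C : i0 \in C).

Local Open Scope classical_set_scope.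

(** The Collatz-Wielandt inequality [l x <= x B]. Pairing [l] with [x] lets both vary in one compact
    set. *)
Definition subinvariant (p : R * 'rV[R]_m) :=
  forall j, p.1 * p.2 ord0 j <= (p.2 *m B) ord0 j.

Definition simplex (x : 'rV[R]_m) :=
  [/\ forall j, 0 <= x ord0 j, forall j, j \notin C -> x ord0 j = 0 &
      \sum_j x ord0 j = 1].

Lemma simplex_le1 x j : simplex x -> x ord0 j <= 1.
Proof.
by move=> [x0 _ <-]; rewrite (bigD1 j) //= lerDl sumr_ge0.
Qed.

Let K := \sum_j \sum_i B i j.

Lemma subinvariant_le l x : simplex x -> subinvariant (l, x) -> l <= K.
Proof.
move=> sx H; have [_ _ sx1] := sx; rewrite -[l]mulr1 -sx1 mulr_sumr; apply: ler_sum => j _.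
apply: le_trans (H j) _; rewrite mxE; apply: ler_sum => i _.
by rewrite -[leRHS]mul1r ler_wpM2r // simplex_le1.
Qed.

(** The admissible pairs with [l >= 0] form a nonempty compact set, on which the first projection
    attains its maximum; a negative [l'] is below it trivially. *)
Lemma subinvariant_max : exists l x, [/\ 0 <= l, simplex x, subinvariant (l, x) &
  forall l' x', simplex x' -> subinvariant (l', x') -> l' <= l].
Proof.
(* The interval for coordinate [j] is [[0, 1]] on [C] and the single point 0 off [C]. *)
pose box := (`[0, K] `*` [set v : 'rV[R]_m | forall j,
   `[0, (j \in C)%:R]%classic (v ord0 j)] : set (R * 'rV[R]_m)).
pose F := [set p : R * 'rV[R]_m | subinvariant p] `&`
          [set p : R * 'rV[R]_m | \sum_j p.2 ord0 j = 1].
have coordC j : continuous (fun p : R * 'rV[R]_m => p.2 ord0 j).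
  by move=> p; apply: (@continuous_comp _ _ _ snd (fun x : 'rV[R]_m => x ord0 j));
    [exact: cvg_snd | exact: coord_continuous].
have sumC (f : R * 'rV[R]_m -> 'I_m -> R) :
    (forall j, continuous (f^~ j)) -> continuous (fun p => \sum_j f p j).
  by move=> fc; apply: continuous_big => // p; exact: add_continuous.
have clF : closed F.
  apply: closedI.
    rewrite (_ : [set p | _] = \bigcap_(j in [set: 'I_m])
       ((fun p : R * 'rV[R]_m => (p.2 *m B) ord0 j - p.1 * p.2 ord0 j) @^-1` [set x | 0 <= x])).
      apply: closed_bigI => j _; apply: preimage_closed => [p _|]; last exact: closed_ge.
      apply: cvgB; last by apply: cvgM; [exact: cvg_fst | exact: coordC].
      under eq_fun do rewrite mxE.
      rewrite mxE; apply: (sumC (fun p i => p.2 ord0 i * B i j)) => i q.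
      by apply: cvgM; [exact: coordC | exact: cvg_cst].
    apply/seteqP; split=> p /= H j; first by move=> _ /=; rewrite subr_ge0; exact: H.
    by have := H j I; rewrite /= subr_ge0.
  apply: (@preimage_closed _ _ (fun p : R * 'rV[R]_m => \sum_j p.2 ord0 j) [set x | x = 1]) => [p _|].
    exact: sumC.
  exact: closed_eq.
have cbox : compact (box `&` F).
  apply: compact_closedI => //; apply: compact_setX; first exact: segment_compact.
  have := @rV_compact R m (fun j => `[0, (j \in C)%:R]).
  by apply=> j; exact: segment_compact.
have boxP l x : 0 <= l -> simplex x -> subinvariant (l, x) -> (box `&` F) (l, x).
  move=> l0 sx H; have [x0 xC sx1] := sx; split; last by split.
  split=> /=; first by rewrite in_itv /= l0 (subinvariant_le sx H).
  move=> j; rewrite /= in_itv /= x0 /=.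
  by case: (boolP (j \in C)) => [_|/xC -> //]; exact: simplex_le1.
have nonempty : box `&` F !=set0.
  exists (0, delta_mx ord0 i0); apply: boxP => //=.
    split=> [j|j jC|]; first by rewrite mxE ler0n.
      by rewrite mxE eqxx /=; case: eqVneq jC => // ->; rewrite i0C.
    rewrite (bigD1 i0) //= big1 ?addr0 ?mxE ?eqxx // => j ji.
    by rewrite mxE (negbTE ji) andbF.
  move=> j; rewrite /= mul0r mxE sumr_ge0 // => i _.
  by rewrite mulr_ge0 // mxE ler0n.
have [|[l x]] := @compact_EVT_max _ _ fst _ nonempty cbox.
  by apply: continuous_subspaceT => p; exact: cvg_fst.
rewrite inE /= => -[[/= lK xb] [sub sx]] lmax.
have l0 : 0 <= l by move: lK; rewrite in_itv => /andP[].
exists l, x; split=> //.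
  split=> // j; have := xb j; rewrite /= in_itv /=; first by case/andP.
  by move=> H /negbTE jC; apply/eqP; move: H; rewrite jC eq_le andbC.
move=> l' x' sx' H; have [l'0|l'0] := leP 0 l'; last by apply: ltW (lt_le_trans l'0 l0).
by apply: (lmax (l', x')); rewrite inE; exact: boxP.
Qed.

Variable P : 'M[R]_m.
Hypotheses (BC : forall i j, j \notin C -> B i j = 0)
  (PB : P *m B = B *m P) (P0 : forall i j, 0 <= P i j)
  (PC : forall i j, i \in C -> j \notin C -> P i j = 0)
  (Pgt0 : forall i j, i \in C -> j \in C -> 0 < P i j).

(** [P] stands for a sum of powers of [B] expressing irreducibility: it turns a nonzero non-negative
    vector supported in [C] into one positive on [C]. If the slack [x B - l x] of a maximal pair
    were nonzero, [y = x P] would satisfy [l y < y B] throughout [C], leaving room for a larger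
    [l]. *)
Lemma perron_vector : exists l (y : 'rV[R]_m), [/\ 0 <= l,
  forall j, j \in C -> 0 < y ord0 j, forall j, j \notin C -> y ord0 j = 0 &
  y *m B = l *: y].
Proof.
have [l [x [l0 sx sub lmax]]] := subinvariant_max.
have [x0 xC sx1] := sx.
have mulP_gt0 (v : 'rV[R]_m) : (forall j, 0 <= v ord0 j) ->
    (forall j, j \notin C -> v ord0 j = 0) -> v != 0 ->
    forall j, j \in C -> 0 < (v *m P) ord0 j.
  move=> v0 vC /rV0Pn[i vi] j jC; rewrite mxE (bigD1 i) //=.
  have iC : i \in C by apply: contraNT vi => /vC ->.
  apply: ltr_pwDl; first by rewrite mulr_gt0 ?Pgt0 // lt_def vi v0.
  by rewrite sumr_ge0 // => a _; rewrite mulr_ge0.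
have xN0 : x != 0.
  apply/eqP => xz; move: sx1; rewrite xz big1 => [|j _]; last by rewrite mxE.
  by move/eqP; rewrite eq_sym oner_eq0.
pose y := x *m P; have ygt0 := mulP_gt0 x x0 xC xN0.
have yC j : j \notin C -> y ord0 j = 0.
  move=> jC; rewrite mxE big1 // => i _.
  by have [iC|/xC->] := boolP (i \in C); rewrite ?mul0r // PC ?mulr0.
have y0 j : 0 <= y ord0 j by have [/ygt0/ltW|/yC->] := boolP (j \in C).
pose z := x *m B - l *: x.
have zE : y *m B = l *: y + z *m P.
  by rewrite mulmxBl -scalemxAl -!mulmxA PB subrKC.
have [zz|zN0] := eqVneq z 0.
  by exists l, y; split=> //; rewrite zE zz mul0mx addr0.
have z0 j : 0 <= z ord0 j by rewrite !mxE subr_ge0; have := sub j; rewrite mxE.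
have zC j : j \notin C -> z ord0 j = 0.
  move=> jC; rewrite !mxE xC // mulr0 subr0 big1 // => i _.
  by rewrite BC ?mulr0.
have wgt0 := mulP_gt0 z z0 zC zN0; set w := z *m P in zE wgt0.
have w0 j : 0 <= w ord0 j.
  by rewrite mxE sumr_ge0 // => i _; rewrite mulr_ge0.
(* As [y j / w j <= D] on [C], [l] can be raised by [D^-1]; dividing [y] by its total [t] brings it
   back to the simplex. *)
pose D := \sum_(j in C) y ord0 j / w ord0 j.
have D0 : 0 < D.
  rewrite /D (bigD1 i0) //= ltr_pwDl ?divr_gt0 ?ygt0 ?wgt0 // sumr_ge0 // => j _.
  by rewrite divr_ge0.
have Dy j : D^-1 * y ord0 j <= w ord0 j.
  have [jC|jC] := boolP (j \in C); last by rewrite yC // mulr0.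
  rewrite ler_pdivrMl // -ler_pdivrMr ?wgt0 // /D (bigD1 j) //= lerDl.
  by rewrite sumr_ge0 // => i _; rewrite divr_ge0.
pose t := \sum_j y ord0 j.
have t0 : 0 < t.
  by rewrite /t (bigD1 i0) //= ltr_pwDl ?ygt0 // sumr_ge0.
have tyE j : (t^-1 *: y) ord0 j = t^-1 * y ord0 j by rewrite mxE.
have : l + D^-1 <= l.
  apply: (lmax _ (t^-1 *: y)) => [|j /=].
    split=> [j|j jC|]; rewrite ?tyE.
    - by rewrite mulr_ge0 // invr_ge0 ltW.
    - by rewrite yC // mulr0.
    - under eq_bigr do rewrite tyE.
      by rewrite -mulr_sumr mulVf // gt_eqF.
  rewrite -scalemxAl zE tyE mulrCA [leRHS]mxE ler_pM2l ?invr_gt0 //.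
  by rewrite [leRHS]mxE [X in _ <= X + _]mxE mulrDl lerD2l.
by rewrite gerDl leNgt invr_gt0 D0.
Qed.
End Perron.

(** * Eigenvalues of block triangular matrices *)

Section StableVector.
Variables (F : fieldType) (m : nat).

(* If [l] is not an eigenvalue, then [A - l] permutes the [A]-stable space of
   vectors supported in [L]; as [y (A - l)] lies in it, so does [y]. *)
Lemma eigenvalue_stable (A : 'M[F]_m) (l : F) (L : {set 'I_m}) (y : 'rV[F]_m) (i : 'I_m) :
  (forall a b, a \in L -> b \notin L -> A a b = 0) ->
  (forall b, b \notin L -> (y *m A) ord0 b = l * y ord0 b) ->
  i \notin L -> y ord0 i != 0 -> eigenvalue A l.
Proof.
move=> LA Ly iL yi; apply: contraNT yi; rewrite negbK => /eqP ker0.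
pose f := A - l%:M.
have freef : row_free f by rewrite -kermx_eq0; apply/eqP.
pose V : 'M[F]_m := diag_mx (\row_j (j \in L)%:R).
have VP n (X : 'M[F]_(n, m)) : (forall a b, b \notin L -> X a b = 0) -> (X <= V)%MS.
  move=> XL; suff -> : X = X *m V by exact: submxMl.
  apply/matrixP=> a b; rewrite mul_mx_diag !mxE.
  by case: (boolP (b \in L)) => bL; rewrite ?mulr1 // mulr0 XL.
have yV : (y *m f <= V)%MS.
  apply: VP => a b bL; rewrite ord1 mulmxBr mul_mx_scalar !mxE.
  by have := Ly b bL; rewrite mxE => ->; rewrite subrr.
have Vf : (V *m f <= V)%MS.
  apply: VP => a b bL; rewrite mul_diag_mx !mxE.
  case: (boolP (a \in L)) => aL; last by rewrite mul0r.
  rewrite mul1r LA // sub0r; case: eqP => [ab|_]; last by rewrite oppr0.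
  by rewrite -ab aL in bL.
(* Injectivity of [f] gives [V *m f] the rank of [V], so the inclusion is an equality. *)
have VVf : (V <= V *m f)%MS.
  by rewrite -(geq_leqif (mxrank_leqif_sup Vf)) mxrankMfree.
have : (y <= V)%MS.
  by rewrite -(submxMfree _ _ freef); exact: submx_trans VVf.
case/submxP => D ->; rewrite mul_mx_diag !mxE (negbTE iL) mulr0 //.
Qed.
End StableVector.

(** * Row sums of powers and strongly connected components *)

Section RowSums.
Variables (R : realType) (m : nat) (A : 'M[R]_m).
Hypothesis A0 : forall i j, 0 <= A i j.

Definition row_sum i n : R := \sum_j (A ^+ n) i j.
Local Notation s := row_sum.

Lemma expmx_ge0 n i j : 0 <= (A ^+ n) i j.
Proof.
elim: n i j => [|n IH] i j; first by rewrite expr0 mxE ler0n.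
by rewrite exprS mxE sumr_ge0 // => k _; rewrite mulr_ge0.
Qed.

Lemma row_sum_ge0 i n : 0 <= s i n.
Proof. by rewrite sumr_ge0 // => j _; exact: expmx_ge0. Qed.

Lemma row_sum0 i : s i 0%N = 1.
Proof.
rewrite /row_sum expr0 (bigD1 i) //= big1 => [|j ji]; rewrite !mxE ?eqxx ?addr0 //.
by rewrite eq_sym (negbTE ji).
Qed.

Lemma row_sumD i k n : s i (k + n) = \sum_j (A ^+ k) i j * s j n.
Proof.
rewrite /row_sum exprD; under eq_bigr do rewrite mxE.
by rewrite exchange_big; apply: eq_bigr => j _; rewrite mulr_sumr.
Qed.

Lemma row_sumS i n : s i n.+1 = \sum_j A i j * s j n.
Proof. by rewrite -add1n row_sumD expr1. Qed.

(** Splitting off the last factor of [A ^+ n.+1] weights each [(A ^+ n) i j] by the row sum [s j 1],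
    which [K] dominates uniformly. *)
Lemma row_sum_ratio : exists2 K, 0 < K & forall i n, s i n.+1 <= K * s i n.
Proof.
exists (1 + \sum_i s i 1%N) => [|i n].
  by rewrite ltr_pwDl // sumr_ge0 // => i _; exact: row_sum_ge0.
rewrite -addn1 row_sumD [s i n]/s mulr_sumr ler_sum // => j _.
rewrite mulrC ler_wpM2r ?expmx_ge0 // (bigD1 j) //= addrCA lerDl.
by rewrite addr_ge0 // sumr_ge0 // => k _; exact: row_sum_ge0.
Qed.

Definition edge : rel 'I_m := fun i j => 0 < A i j.

(** Along an edge [i -> k], [A i k * s k n <= s i n.+1 <= K * s i n]: the ratio bound undoes the
    shift in time. Such bounds compose along a path. *)
Lemma row_sum_connect i j : connect edge i j ->
  exists2 C, 0 < C & forall n, s j n <= C * s i n.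
Proof.
have [K K0 HK] := row_sum_ratio.
case/connectP => p + ->; elim: p i => [|k p IH] i /=.
  by move=> _; exists 1 => // n; rewrite mul1r.
move=> /andP[eik /IH[C C0 HC]]; exists (C * (K / A i k)) => [|n].
  by rewrite !mulr_gt0 ?invr_gt0.
apply: le_trans (HC n) _; rewrite -mulrA ler_pM2l // mulrAC ler_pdivlMr //.
apply: le_trans (HK i n); rewrite row_sumS (bigD1 k) //= mulrC lerDl.
by rewrite sumr_ge0 // => j' _; rewrite mulr_ge0 ?row_sum_ge0.
Qed.

Definition scc i := [set j | connect edge i j && connect edge j i].

(** The eigenvector equation is claimed only on the component, since [y A] may also be positive at
    vertices below it. The Perron vector is that of [A] cut down to the component. *)
Lemma perron_scc i : exists l (y : 'rV[R]_m), [/\ 0 <= l,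
  forall j, j \in scc i -> 0 < y ord0 j,
  forall j, j \notin scc i -> y ord0 j = 0 &
  forall j, j \in scc i -> (y *m A) ord0 j = l * y ord0 j].
Proof.
pose C := scc i.
pose B : 'M[R]_m := \matrix_(a, b) if (a \in C) && (b \in C) then A a b else 0.
have iC : i \in C by rewrite inE connect0.
have B0 a b : 0 <= B a b by rewrite mxE; case: ifP.
have BC a b : b \notin C -> B a b = 0 by move=> /negbTE bC; rewrite mxE bC andbF.
have BX0 n a b : 0 <= (B ^+ n) a b.
  elim: n a b => [|n IH] a b; first by rewrite expr0 mxE ler0n.
  by rewrite exprS mxE sumr_ge0 // => k _; rewrite mulr_ge0.
have BXC n a b : a \in C -> b \notin C -> (B ^+ n) a b = 0.
  case: n => [|n] aC bC.
    by rewrite expr0 mxE; case: eqP => // ab; rewrite -ab aC in bC.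
  by rewrite exprSr mxE big1 // => k _; rewrite BC ?mulr0.
(* Every vertex on a path between two vertices of [C] lies in [C], so the path survives in [B]. *)
have walk a b : a \in C -> b \in C -> exists n, 0 < (B ^+ n) a b.
  move=> + bC; have : connect edge a b -> a \in C -> exists n, 0 < (B ^+ n) a b.
    case/connectP => p + bE; elim: p a bE => [|k p IH] a /=.
      by move=> -> _ _; exists 0%N; rewrite expr0 mxE eqxx.
    move=> bE /andP[ak kp] aC.
    have kC : k \in C.
      move: aC bC; rewrite !inE => /andP[ia _] /andP[_ bi].
      rewrite (connect_trans ia (connect1 ak)) (connect_trans _ bi) //.
      by apply/connectP; exists p.
    have [n Hn] := IH k bE kp kC; exists n.+1.
    rewrite exprS mxE (bigD1 k) //= ltr_pwDl //.
      by rewrite mulr_gt0 // mxE aC kC.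
    by rewrite sumr_ge0 // => j _; rewrite mulr_ge0.
  move=> H aC; apply: H => //; move: aC bC; rewrite !inE => /andP[_ ai] /andP[ib _].
  exact: connect_trans ib.
have [N HN] : exists N : 'I_m * 'I_m -> nat, forall p,
    p.1 \in C -> p.2 \in C -> 0 < (B ^+ N p) p.1 p.2.
  apply: (@fin_all_exists _ _ (fun p n =>
    p.1 \in C -> p.2 \in C -> 0 < (B ^+ n) p.1 p.2)) => -[a b] /=.
  have [aC|] := boolP (a \in C); last by exists 0%N.
  have [bC|] := boolP (b \in C); last by exists 0%N.
  by have [n Hn] := walk a b aC bC; exists n.
(* For each pair in [C] one summand is positive at that pair, and powers of [B] commute with [B]. *)
pose P := \sum_p B ^+ N p.
have [||||l [y [l0 yC yC' yB]]] := @perron_vector R m B C i B0 iC P BC.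
- by rewrite !mulmxE mulr_suml mulr_sumr; apply: eq_bigr => p _; rewrite -exprS -exprSr.
- by move=> a b; rewrite summxE sumr_ge0.
- by move=> a b aC bC; rewrite summxE big1 // => p _; exact: BXC.
- move=> a b aC bC; rewrite summxE (bigD1 (a, b)) //= ltr_pwDl ?sumr_ge0 //.
  exact: HN.
exists l, y; split=> // j jC; have := congr1 (fun v : 'rV_m => v ord0 j) yB.
rewrite /= !mxE => <-; apply: eq_bigr => k _; rewrite mxE jC andbT.
by case: ifPn => // /yC' ->; rewrite !mul0r.
Qed.

Lemma row_sum_growth i : polyexp_growth (eigenvalue A) (s i).
Proof.
have [n] := ubnP #|[set j | connect edge i j]|; elim: n i => // n IH i Hn.
have [l [y [l0 yC yC' yA]]] := perron_scc i.
have iC : i \in scc i by rewrite inE connect0.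
have y0 j : 0 <= y ord0 j by have [/yC/ltW|/yC'->] := boolP (j \in scc i).
(* The defect [y A - l y] lives on vertices reachable from [i] that cannot return to [i]; it weights
   the forcing term. *)
pose w j := (y *m A) ord0 j - l * y ord0 j.
have wC j : j \in scc i -> w j = 0 by move=> jC; rewrite /w yA // subrr.
have w0 j : 0 <= w j.
  have [/wC->//|jC] := boolP (j \in scc i); rewrite /w (yC' _ jC) mulr0 subr0 mxE.
  by rewrite sumr_ge0 // => k _; rewrite mulr_ge0.
have connectw j : w j != 0 -> connect edge i j && ~~ connect edge j i.
  move=> wj; have jC : j \notin scc i by apply: contraNN wj => /wC ->.
  have ij : connect edge i j; last by move: jC; rewrite inE ij.
  apply: contraNT wj => ij; rewrite /w (yC' _ jC) mulr0 subr0 mxE big1 // => k _.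
  have [kC|/yC'->] := boolP (k \in scc i); last by rewrite mul0r.
  have [akj|] := boolP (edge k j); last first.
    by rewrite /edge lt_def A0 andbT negbK => /eqP ->; rewrite mulr0.
  move: kC; rewrite inE => /andP[ik _].
  by rewrite (connect_trans ik (connect1 akj)) in ij.
have evl : eigenvalue A l.
  (* The vertices strictly below the component are closed under edges, and off them [y] satisfies
     the eigenvector equation. *)
  apply: (@eigenvalue_stable _ _ A l
    [set j | connect edge i j && ~~ connect edge j i] y i) => [a b|b||].
  - rewrite !inE => /andP[ia ai] H; apply/eqP; apply: contraNT H => Aab.
    have ab : connect edge a b by rewrite connect1 // /edge lt_def Aab A0.
    rewrite (connect_trans ia ab) /=; apply: contraNN ai; exact: connect_trans.
  - move=> H; apply/eqP; rewrite -subr_eq0; apply: contraNT H => wb.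
    by rewrite inE connectw.
  - by rewrite inE connect0.
  - by rewrite gt_eqF // yC.
pose u k := \sum_j y ord0 j * s j k.
have ugrowth : polyexp_growth (eigenvalue A) u.
  apply: (@rec_growth _ l u (fun k => \sum_(j | w j != 0) w j * s j k)) => //.
  - rewrite /u (bigD1 i) //= row_sum0 mulr1 ltr_pwDl ?yC // sumr_ge0 // => j _.
    by rewrite mulr_ge0 ?row_sum_ge0.
  - by move=> k; rewrite sumr_ge0 // => j _; rewrite mulr_ge0 ?row_sum_ge0.
  - move=> k; rewrite /u; under eq_bigr do rewrite row_sumS mulr_sumr.
    rewrite exchange_big mulr_sumr (big_mkcond (fun j => w j != 0)) -big_split /=.
    apply: eq_bigr => a _.
    rewrite (_ : (if _ then _ else _) = w a * s a k); last first.
      by case: eqVneq => [->|]; rewrite ?mul0r.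
    rewrite /w mxE mulrBl mulrA subrKC mulr_suml.
    by apply: eq_bigr => j _; rewrite mulrA.
  apply: polyexp_growth_sum => j wj.
  have [ij ji] := andP (connectw j wj).
  have [|l' [d [l0' Sl' H]]] := IH j.
    (* [j] reaches only vertices reachable from [i] and misses [i] itself, so its reachable set is
       strictly smaller. *)
    rewrite ltnS in Hn; apply: leq_trans Hn; apply: proper_card; apply/properP; split.
      by apply/fintype.subsetP => k; rewrite !inE; exact: connect_trans.
    by exists i; rewrite !inE ?connect0.
  exists l', d; split=> //.
  by apply: (@is_Theta_comparable _ _ _ _ (w j) (w j)) H => [||k];
    rewrite ?lexx // lt_def wj w0.
(* For unreachable [j] the value 1 is a filler, since [y] vanishes there. *)
have [D HD] : exists D : 'I_m -> R, forall j,
    0 < D j /\ (connect edge i j -> forall k, s j k <= D j * s i k).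
  apply: (@fin_all_exists _ _ (fun j d => 0 < d /\
    (connect edge i j -> forall k, s j k <= d * s i k))) => j.
  have [/row_sum_connect[d d0 Hd]|_] := boolP (connect edge i j); last by exists 1.
  by exists d.
have [l' [d [l0' Sl' H]]] := ugrowth; exists l', d; split=> //.
(* This gives [y_i s_i <= u <= E s_i], so [s_i] inherits the growth of [u]. *)
pose E := \sum_j y ord0 j * D j.
have E0 : 0 < E.
  rewrite /E (bigD1 i) //= ltr_pwDl ?mulr_gt0 ?yC //; first by have [] := HD i.
  by rewrite sumr_ge0 // => j _; rewrite mulr_ge0 // ltW //; have [] := HD j.
apply: (@is_Theta_comparable _ u (s i) _ E^-1 (y ord0 i)^-1) => //.
- by rewrite invr_gt0.
- by rewrite invr_gt0 yC.
move=> k; apply/andP; split.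
  rewrite ler_pdivrMl // mulr_suml; apply: ler_sum => j _.
  have [jC|/yC'->] := boolP (j \in scc i); last by rewrite !mul0r.
  rewrite -mulrA ler_wpM2l //.
  by have [_] := HD j; apply; move: jC; rewrite inE => /andP[].
rewrite ler_pdivlMl ?yC // /u (bigD1 i) //= lerDl sumr_ge0 // => j _.
by rewrite mulr_ge0 ?row_sum_ge0.
Qed.
End RowSums.

(** * Natural matrices and transposition *)

Lemma trmxX (S : comPzSemiRingType) n (A : 'M[S]_n) k : (A ^+ k)^T = A^T ^+ k.
Proof.
elim: k => [|k IH]; first by rewrite !expr0 trmx1.
by rewrite exprS exprSr -IH -!mulmxE trmx_mul.
Qed.

(** [eigenvalue] refers to row vectors, so the comparison goes through the characteristic
    polynomial, a determinant invariant under transposition. *)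
Lemma in_Spec_trmx (R : realType) m (M : 'M[nat]_m) (z : R[i]) :
  in_Spec M^T z = in_Spec M z.
Proof.
rewrite /in_Spec !eigenvalue_root_char /root /char_poly /char_poly_mx.
by rewrite -!map_trmx -[in RHS]det_tr linearB /= tr_scalar_mx.
Qed.

Lemma nat_row_sum_growth (R : realType) m (M : 'M[nat]_m) (i : 'I_m) :
  exists (lambda : R) (d : nat), [/\ 0 <= lambda, in_Spec M (lambda%:C)%C &
    is_Theta (fun n : nat => (\sum_(j < m) (M ^+ n) i j)%:R : R)
             (fun n : nat => n%:R ^+ d * lambda ^+ n)].
Proof.
pose A : 'M[R]_m := map_mx (fun k : nat => k%:R) M.
have A0 a b : 0 <= A a b by rewrite mxE.
have [l [d [l0 ev H]]] := row_sum_growth A0 i.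
have AX n a b : (A ^+ n) a b = ((M ^+ n) a b)%:R.
  elim: n a b => [|n IH] a b; first by rewrite !expr0 !mxE; case: (a == b).
  by rewrite !exprS !mxE natr_sum; apply: eq_bigr => k _; rewrite natrM IH mxE.
exists l, d; split=> //.
  rewrite /in_Spec; have -> : map_mx (fun k : nat => k%:R : R[i]) M = map_mx (real_complex R) A.
    by apply/matrixP => a b; rewrite !mxE rmorph_nat.
  by rewrite eigenvalue_map.
apply: is_Theta_eq H => n; rewrite natr_sum; apply: eq_bigr => j _; exact: AX.
Qed.

Theorem proposition16 (R : realType) (m : nat) (M : 'M[nat]_m) :
  (forall i : 'I_m, exists (lambda : R) (d : nat),
     [/\ 0 <= lambda, in_Spec M (lambda%:C)%C &
       is_Theta (fun n : nat => (\sum_(j < m) (M ^+ n) i j)%:R : R)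
                (fun n : nat => n%:R ^+ d * lambda ^+ n)]) /\
  (forall j : 'I_m, exists (lambda : R) (d : nat),
     [/\ 0 <= lambda, in_Spec M (lambda%:C)%C &
       is_Theta (fun n : nat => (\sum_(i < m) (M ^+ n) i j)%:R : R)
                (fun n : nat => n%:R ^+ d * lambda ^+ n)]).
Proof.
split=> [|j]; first exact: nat_row_sum_growth.
have [l [d [l0 ev H]]] := nat_row_sum_growth R M^T j.
exists l, d; split; [exact: l0 | by rewrite -in_Spec_trmx |].
apply: is_Theta_eq H => n; congr _%:R; apply: eq_bigr => i _.
by rewrite -trmxX mxE.
Qed.
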